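(* The minimum size $f(d)$ of a double cover of $\{0,1,2\}^d$ satisfies $f(4)\ge 19>16=2^4$ and $f(5)\ge 33>32=2^5$. In particular $f(d)\ge 2^d$ holds for $d=4$ and $d=5$.
   Context: Write $[3]=\{0,1,2\}$. A proper sub-box of $[3]^d$ is a set $B=S_1\times\dots\times S_d$ with $\varnothing\neq S_i\subsetneq[3]$ for every $1\le i\le d$ (so each side $S_i$ has one or two elements). A double cover of $[3]^d$ is a finite multiset $\{B_1,\dots,B_m\}$ of proper sub-boxes such that every point of $[3]^d$ lies in exactly two of the $B_j$, counted with multiplicity; its size is $m$. $f(d)$ denotes the minimum size of a double cover of $[3]^d$. The base value $f(3)=11$ is taken as known (it is established by exhaustive computation). *)

(* Defs.v *)
From mathcomp Require Import all_boot.

Set Implicit Arguments.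
Unset Strict Implicit.
Unset Printing Implicit Defensive.

(* 'I_3 = {0, 1, 2} plays the role of [3]. *)
Definition point (d : nat) := {ffun 'I_d -> 'I_3}.

Definition box (d : nat) (S : {ffun 'I_d -> {set 'I_3}}) : {set point d} :=
  [set x : point d | [forall i, x i \in S i]].

Definition proper_sides (d : nat) (S : {ffun 'I_d -> {set 'I_3}}) : bool :=
  [forall i, (S i != set0) && (S i \proper [set: 'I_3])].

Definition proper_subbox (d : nat) (B : {set point d}) : bool :=
  [exists S : {ffun 'I_d -> {set 'I_3}}, proper_sides S && (B == box S)].

(* A finite multiset of boxes is represented by any sequence listing its
   members with multiplicity; neither this predicate nor the size depends on
   the order of the listing. *)
Definition double_cover (d : nat) (Bs : seq {set point d}) : bool :=
  all (@proper_subbox d) Bs &&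
  [forall x : point d, count (fun B : {set point d} => x \in B) Bs == 2].

(* All singletons, each taken twice, form a double cover, so the minimum below
   ranges over a nonempty set of sizes. *)
Lemma double_cover_exists (d : nat) :
  exists m, [exists Bs : m.-tuple {set point d}, double_cover Bs].
Proof.
pose s : seq {set point d} := [seq [set x] | x <- enum {: point d}].
exists (size (s ++ s)); apply/existsP; exists (in_tuple (s ++ s)).
rewrite /double_cover /=; apply/andP; split.
  rewrite all_cat andbb; apply/allP => _ /mapP[x _ ->].
  apply/existsP; exists [ffun i => [set x i]]; apply/andP; split.
    apply/forallP => i; rewrite ffunE -card_gt0 cards1 /=.
    by rewrite properEcard subsetT cards1 cardsT card_ord.
  apply/eqP/setP => y; rewrite !inE; apply/eqP/forallP => [-> i|xy].
    by rewrite ffunE set11.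
  by apply/ffunP => i; move: (xy i); rewrite ffunE => /set1P.
apply/forallP => x; rewrite count_cat count_map.
rewrite (eq_count (a2 := pred1 x)); last by move=> y; rewrite /= inE eq_sym.
by rewrite (count_uniq_mem _ (enum_uniq _)) mem_enum.
Qed.

Definition f (d : nat) : nat := ex_minn (double_cover_exists d).

(* Main.v *)
Require Import Defs.
From mathcomp Require Import all_boot.
From mathcomp Require Import zify.

(** Let n_i be the number of boxes of a double cover whose i-th side is a
singleton. The boxes meeting a layer x_i = a form a double cover one dimension
lower, and summing over a gives 3 f(d-1) + n_i <= 2m. Conversely a box with k
singleton sides has volume 2^(d-k) >= 2^d - k 2^(d-1), while the volumes add up
to 2 * 3^d, so a small cover needs many singleton sides. Combining both bounds
yields f(3) >= 11 from f(2) >= 6, and f(4) >= 19 from f(3) >= 11. For d = 5,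
since 4 does not divide 2 * 3^5, some box has at least four singleton sides,
which makes the volume bound strict enough for 33. For f(2) >= 6 one also uses
that every line in direction i meets an even number of boxes with a singleton
i-th side, so that n_i is never 1. *)

Set Implicit Arguments.
Unset Strict Implicit.
Unset Printing Implicit Defensive.

Notation sides d := {ffun 'I_d -> {set 'I_3}}.

(** Listing side families instead of point sets keeps the side sizes at hand; [cover_bound_f]
    carries the bounds back to covers by sets. *)
Definition sides_cover d (Ss : seq (sides d)) : Prop :=
  all (@proper_sides d) Ss /\
  forall x : point d, count (fun s => x \in box s) Ss = 2.

Definition thin d (i : 'I_d) (s : sides d) : bool :=
  #|s i| == 1.

Definition slice d (i : 'I_d.+1) (s : sides d.+1) :
  sides d := [ffun j => s (lift i j)].

Definition extend d (i : 'I_d.+1) (a : 'I_3) (y : point d) : point d.+1 :=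
  [ffun k => if unlift i k is Some j then y j else a].

Definition cover_bound d g : Prop :=
  forall Ss : seq (sides d), sides_cover Ss -> g <= size Ss.

Lemma countE (T : Type) (P : pred T) s : count P s = \sum_(x <- s) P x.
Proof. by rewrite -sum1_count big_mkcond; apply: eq_bigr => x _; case: (P x). Qed.

Lemma sum_nat_seq_const (T : Type) (s : seq T) n : \sum_(x <- s) n = n * size s.
Proof. by rewrite -sum1_size big_distrr /=; under [RHS]eq_bigr do rewrite muln1. Qed.

Lemma card_thin d (i : 'I_d) s : proper_sides s -> #|s i| + thin i s = 2.
Proof.
move=> /forallP/(_ i)/andP[]; rewrite -card_gt0 properEcard cardsT card_ord /thin.
by case: #|s i| => [|[|[|n]]] // _ /andP[].
Qed.

Lemma in_box_extend d (i : 'I_d.+1) a y s :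
  (extend i a y \in box s) = (a \in s i) && (y \in box (slice i s)).
Proof.
rewrite !inE; apply/forallP/andP => [H|[Ha /forallP Hy] k].
  split; first by have := H i; rewrite ffunE unlift_none.
  by apply/forallP => j; have := H (lift i j); rewrite !ffunE liftK.
rewrite ffunE; case: unliftP => [j ->|-> //].
by have := Hy j; rewrite ffunE.
Qed.

Lemma cover_slice d (i : 'I_d.+1) a (Ss : seq (sides d.+1)) : sides_cover Ss ->
  sides_cover [seq slice i s | s : sides d.+1 <- Ss & a \in s i].
Proof.
case=> /allP prop cov; split.
  apply/allP => _ /mapP[s + ->]; rewrite mem_filter => /andP[_ /prop/forallP pS].
  by apply/forallP => j; rewrite ffunE.
move=> y; rewrite -[RHS](cov (extend i a y)) count_map count_filter.
by apply: eq_count => s /=; rewrite in_box_extend andbC.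
Qed.

Lemma sum_mem (A : {set 'I_3}) : \sum_a (a \in A) = #|A|.
Proof. by rewrite -sum1_card [RHS]big_mkcond; apply: eq_bigr => a _; case: (a \in A). Qed.

(** A box meets two layers in direction [i], or one if it is thin there, so the layer counts add up
    to [2 * size Ss - count (thin i) Ss]. *)
Lemma thin_count_bound d g (i : 'I_d.+1) (Ss : seq (sides d.+1)) :
  cover_bound d g -> sides_cover Ss ->
  3 * g + count (thin i) Ss <= 2 * size Ss.
Proof.
move=> lb cov; have [/allP prop _] := cov.
have layers : 3 * g <= \sum_(a < 3) count (fun s : sides d.+1 => a \in s i) Ss.
  rewrite -[3 in leqLHS](card_ord 3) -sum_nat_const; apply: leq_sum => a _.
  by rewrite -size_filter -(size_map (slice i)); apply/lb/cover_slice.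
suff -> : 2 * size Ss =
    \sum_(a < 3) count (fun s : sides d.+1 => a \in s i) Ss + count (thin i) Ss.
  by rewrite leq_add2r.
under eq_bigr do rewrite countE.
rewrite exchange_big countE -big_split /= -sum_nat_seq_const.
by apply: eq_big_seq => s /prop pS; rewrite sum_mem card_thin.
Qed.

(** The three points of the line are covered 6 times in total, while a box meeting the line contains
    two of them, or one if it is thin. *)
Lemma line_thin_even d (i : 'I_d.+1) y (Ss : seq (sides d.+1)) :
  sides_cover Ss ->
  ~~ odd (count (fun s => thin i s && (y \in box (slice i s))) Ss).
Proof.
case=> /allP prop cov.
suff : 6 + count (fun s => thin i s && (y \in box (slice i s))) Ss =
       2 * count (fun s => y \in box (slice i s)) Ss by lia.
have -> : 6 = \sum_(a < 3) count (fun s => extend i a y \in box s) Ss.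
  by under eq_bigr do rewrite cov; rewrite sum_nat_const card_ord.
under eq_bigr do rewrite countE.
rewrite exchange_big !countE -big_split big_distrr /=.
apply: eq_big_seq => s /prop pS.
under eq_bigr do rewrite in_box_extend.
case: (y \in _); last by rewrite andbF big1 // => a _; rewrite andbF.
by under eq_bigr do rewrite andbT; rewrite sum_mem andbT muln1 card_thin.
Qed.

Lemma thin_count_neq1 d (i : 'I_d.+1) (Ss : seq (sides d.+1)) :
  sides_cover Ss -> count (thin i) Ss != 1.
Proof.
move=> cov; have [/allP prop _] := cov; apply/eqP => n1.
have /hasP[s SSs thS] : has (thin i) Ss by rewrite has_count n1.
have ne j : exists a, a \in s j.
  by have /forallP/(_ j)/andP[/set0Pn] := prop _ SSs.
(* The line in direction [i] over [y] meets [s], the only thin box, which contradicts parity. *)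
pose y : point d := [ffun j => xchoose (ne (lift i j))].
have := line_thin_even i y cov.
set c := count _ Ss.
have : c <= 1 by rewrite -n1; apply: sub_count => T /andP[].
have : 0 < c.
  rewrite -has_count; apply/hasP; exists s => //; rewrite thS inE.
  by apply/forallP => j; rewrite !ffunE; exact: xchooseP.
by case: c => [|[]].
Qed.

Lemma card_box d (s : sides d) : #|box s| = \prod_i #|s i|.
Proof.
by rewrite -cardsXn; apply: eq_card => x; rewrite in_setXn.
Qed.

Lemma card_box_thin d (s : sides d) : proper_sides s ->
  #|box s| * 2 ^ (\sum_i thin i s) = 2 ^ d.
Proof.
move=> pS; rewrite card_box expn_sum -big_split /=.
rewrite -[d in RHS]card_ord -prod_nat_const; apply: eq_bigr => i _.
by have := card_thin i pS; case: thin; case: #|s i| => [|[|[|]]].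
Qed.

Lemma sum_card_box d (Ss : seq (sides d)) : sides_cover Ss ->
  \sum_(s <- Ss) #|box s| = 2 * 3 ^ d.
Proof.
case=> _ cov; under eq_bigr do rewrite -sum1_card big_mkcond /=.
rewrite exchange_big /= (eq_bigr (fun=> 2)) => [|x _].
  by rewrite sum_nat_const card_ffun !card_ord mulnC.
by rewrite -[RHS](cov x) countE; apply: eq_bigr => s _; case: (x \in _).
Qed.

(** Equality holds with at most one thin side; from two on, the thin term alone reaches
    [2 ^ d.+1]. *)
Lemma card_box_lower d (s : sides d.+1) : proper_sides s ->
  2 ^ d.+1 <= #|box s| + 2 ^ d * \sum_i thin i s.
Proof.
move/card_box_thin; rewrite expnS; case: (\sum_i _) => [|[|k]]; nia.
Qed.

Lemma sum_thin d (Ss : seq (sides d)) :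
  \sum_(s <- Ss) \sum_i thin i s = \sum_i count (thin i) Ss.
Proof. by rewrite exchange_big; apply: eq_bigr => i _; rewrite countE. Qed.

Lemma volume_bound d (Ss : seq (sides d.+1)) : sides_cover Ss ->
  2 ^ d.+1 * size Ss <= 2 * 3 ^ d.+1 + 2 ^ d * \sum_i count (thin i) Ss.
Proof.
move=> cov; have [/allP prop _] := cov.
rewrite -(sum_card_box cov) -sum_thin big_distrr -big_split /=.
rewrite -sum_nat_seq_const [leqLHS]big_seq [leqRHS]big_seq.
by apply: leq_sum => s /prop/card_box_lower.
Qed.

Lemma thin_total_bound d g (Ss : seq (sides d.+1)) :
  cover_bound d g -> sides_cover Ss ->
  d.+1 * (3 * g) + \sum_i count (thin i) Ss <= d.+1 * (2 * size Ss).
Proof.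
move=> lb cov.
have : \sum_(i < d.+1) (3 * g + count (thin i) Ss) <=
       \sum_(i < d.+1) 2 * size Ss.
  by apply: leq_sum => i _; apply: thin_count_bound.
by rewrite big_split /= !sum_nat_const card_ord.
Qed.

Lemma cover_bound0 : cover_bound 0 2.
Proof.
move=> Ss [_ cov]; rewrite -[leqLHS](cov [ffun=> ord0]); exact: count_size.
Qed.

Lemma cover_bound1 : cover_bound 1 3.
Proof.
move=> Ss cov; have := thin_count_bound ord0 cover_bound0 cov; lia.
Qed.

(** With at most 5 boxes, [9 + n_i <= 10] and [n_i != 1] force [n_i = 0]. Then every box has 4
    points, but 4 does not divide 18. *)
Lemma cover_bound2 : cover_bound 2 6.
Proof.
move=> Ss cov; rewrite leqNgt; apply/negP => small.
have [/allP prop _] := cov.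
have thin0 i : count (thin i) Ss = 0.
  have := thin_count_bound i cover_bound1 cov.
  have := thin_count_neq1 i cov; lia.
suff : \sum_(s <- Ss) #|box s| = 4 * size Ss by rewrite sum_card_box //; lia.
rewrite -sum_nat_seq_const; apply: eq_big_seq => s SSs.
have := card_box_thin (prop s SSs); rewrite big1 ?muln1 // => i _.
have : ~~ has (thin i) Ss by rewrite has_count thin0.
by move/hasPn/(_ s SSs)/negbTE->.
Qed.

Lemma cover_bound3 : cover_bound 3 11.
Proof.
move=> Ss cov; have := thin_total_bound cover_bound2 cov.
(* For [m] boxes with [N] thin sides in total, [54 + N <= 6 * m] and [8 * m <= 54 + 4 * N] give
   [162 <= 16 * m]. *)
have := volume_bound cov; rewrite /expn /=; lia.
Qed.

Lemma cover_bound4 : cover_bound 4 19.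
Proof.
move=> Ss cov; have := thin_total_bound cover_bound3 cov.
have := volume_bound cov; rewrite /expn /=; lia.
Qed.

(** A box with at most three thin sides has a volume divisible by 4, but the total volume 486 is
    not. *)
Lemma exists_four_thin (Ss : seq (sides 5)) : sides_cover Ss ->
  has (fun s => 4 <= \sum_i thin i s) Ss.
Proof.
move=> cov; have [/allP prop _] := cov; apply: contraT => /hasPn few.
suff : 4 %| \sum_(s <- Ss) #|box s| by rewrite sum_card_box.
rewrite big_seq; apply: dvdn_sum => s SSs.
have := card_box_thin (prop s SSs); have := few s SSs.
by case: (\sum_i _) => [|[|[|[|k]]]] // _; rewrite /expn /=; lia.
Qed.

Lemma volume_bound5 (Ss : seq (sides 5)) : sides_cover Ss ->
  32 * size Ss + 32 <= 486 + 16 * \sum_i count (thin i) Ss.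
Proof.
move=> cov; have [/allP prop _] := cov.
have /hasP[s SSs four] := exists_four_thin cov.
have -> : 486 = \sum_(s <- Ss) #|box s| by rewrite sum_card_box.
rewrite -sum_thin big_distrr -big_split /= (perm_size (perm_to_rem SSs)) /=.
rewrite (perm_big _ (perm_to_rem SSs)) big_cons mulnS addnAC leq_add //.
  (* Since [16 * 4 = 32 + 32], the thin term of [s] pays for its own 32 and for the extra 32. *)
  exact: leq_trans (leq_mul (leqnn 16) four) (leq_addl _ _).
rewrite -sum_nat_seq_const [leqLHS]big_seq [leqRHS]big_seq.
by apply: leq_sum => T /mem_rem/prop/card_box_lower.
Qed.

Lemma cover_bound5 : cover_bound 5 33.
Proof.
move=> Ss cov; have := thin_total_bound cover_bound4 cov.
(* Eliminating the thin total leaves [4106 <= 128 * m]; without the extra 32 it would be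
   [4074 <= 128 * m], which only gives [32 <= m]. *)
have := volume_bound5 cov; lia.
Qed.

Lemma cover_bound_f d g : cover_bound d g -> g <= f d.
Proof.
rewrite /f => lb; case: ex_minnP => m /existsP[[Bs /= /eqP <-]] /andP[prop cov] _.
have [Ss pSs BsE] : exists2 Ss, all (@proper_sides d) Ss & Bs = map (@box d) Ss.
  elim: Bs prop {cov} => [|B Bs IH] /=; first by exists [::].
  case/andP => /existsP[s /andP[pS /eqP->]] /IH[Ss pSs ->].
  by exists (s :: Ss); rewrite //= pS.
rewrite BsE size_map; apply: lb; split=> // x.
by have /eqP := forallP cov x; rewrite BsE count_map.
Qed.

Theorem corollary4p4 :
  [/\ 19 <= f 4 /\ (16 < 19 /\ 16 = 2 ^ 4),
      33 <= f 5 /\ (32 < 33 /\ 32 = 2 ^ 5)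
    & forall d : nat, d = 4 \/ d = 5 -> 2 ^ d <= f d].
Proof.
have f4 := cover_bound_f cover_bound4.
have f5 := cover_bound_f cover_bound5.
by split=> // d [->|->]; [apply: leq_trans f4 | apply: leq_trans f5].
Qed.
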